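(* Let $\Omega\subset\mathbb{R}^3$ be a periodic box and let $\mathbf{p}^n=(\boldsymbol{n}_1^n,\boldsymbol{n}_2^n,\boldsymbol{n}_3^n)$ and $\mathbf{p}^{n+1}=(\boldsymbol{n}_1^{n+1},\boldsymbol{n}_2^{n+1},\boldsymbol{n}_3^{n+1})$ be smooth periodic fields on $\Omega$ with values in $SO(3)$. Define $D^B_{\mathcal{F}}(\mathbf{p})|^{n+\frac12}$ as the $3\times 3$ matrix field with columns $D^B_{\mathcal{F}}(\mathbf{p})|_i^{n+\frac12}$, $i=1,2,3$, $$D^B_{\mathcal{F}}(\mathbf{p})\Big|_i^{n+\frac12}=-\gamma_i\nabla\cdot(\nabla\boldsymbol{n}_i^{n+\frac12})-k_i\nabla(\nabla\cdot\boldsymbol{n}_i^{n+\frac12})+\sum_{j=1}^3k_{ji}\nabla\times\big(\beta_{ji}^{n+\frac12}\boldsymbol{n}_j^{n+\frac12}\big)+\sum_{j=1}^3k_{ij}\beta_{ij}^{n+\frac12}\big(\nabla\times\boldsymbol{n}_j^{n+\frac12}\big),$$ $$\beta_{ij}^{n+\frac12}=\tfrac12\big(\boldsymbol{n}_i^{n+1}\cdot\nabla\times\boldsymbol{n}_j^{n+1}+\boldsymbol{n}_i^n\cdot\nabla\times\boldsymbol{n}_j^n\big),\qquad \boldsymbol{n}_i^{n+\frac12}=\tfrac12(\boldsymbol{n}_i^{n+1}+\boldsymbol{n}_i^n).$$ Then $D^B_{\mathcal{F}}(\mathbf{p})|^{n+\frac12}$ is a second-order discrete gradient approximation of the energy variation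 $\delta\mathcal{F}_{Bi}[\mathbf{p}]/\delta\mathbf{p}$ (that is, if $\mathbf{p}^n=\mathbf{p}(t_n)$ and $\mathbf{p}^{n+1}=\mathbf{p}(t_n+\tau)$ for a smooth field $\mathbf{p}(\boldsymbol{x},t)$, it equals $\frac{\delta\mathcal{F}_{Bi}}{\delta\mathbf{p}}$ at $\mathbf{p}(t_n+\tau/2)$ up to $O(\tau^2)$), and it satisfies the energy difference relation $$\int_\Omega D^B_{\mathcal{F}}(\mathbf{p})\Big|^{n+\frac12}\cdot(\mathbf{p}^{n+1}-\mathbf{p}^n)\,dV=\mathcal{F}_{Bi}[\mathbf{p}^{n+1}]-\mathcal{F}_{Bi}[\mathbf{p}^n].$$
   Context: $SO(3)=\{\Lambda\in\mathbb{R}^{3\times3}:\Lambda^{\top}\Lambda=\mathbf{I},\ \det\Lambda=1\}$; $\boldsymbol{n}_i$ are the columns of $\mathbf{p}$, and $\mathbf{a}\cdot\mathbf{b}=\sum_{i,j}a_{ij}b_{ij}$ for matrices. Given constants $\gamma_i>0$, $k_i\ge0$, $k_{ij}\ge0$ ($i,j=1,2,3$), the biaxial elastic energy (under periodic boundary conditions) is $$\mathcal{F}_{Bi}[\mathbf{p}]=\int_\Omega\frac12\Big(\sum_{i=1}^3\gamma_i|\nabla\boldsymbol{n}_i|^2+\sum_{i=1}^3k_i(\nabla\cdot\boldsymbol{n}_i)^2+\sum_{i,j=1}^3k_{ij}(\boldsymbol{n}_i\cdot\nabla\times\boldsymbol{n}_j)^2\Big)dV,$$ where $|\nabla\boldsymbol{n}|^2=\sum_{k,l}(\partial_kn_l)^2$.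 Its variational derivative $\frac{\delta\mathcal{F}_{Bi}}{\delta\mathbf{p}}$ is the matrix field with columns $$\frac{\delta\mathcal{F}_{Bi}[\mathbf{p}]}{\delta\boldsymbol{n}_i}=-\gamma_i\Delta\boldsymbol{n}_i-k_i\nabla(\nabla\cdot\boldsymbol{n}_i)+\sum_{j=1}^3k_{ji}\nabla\times\big[(\boldsymbol{n}_j\cdot\nabla\times\boldsymbol{n}_i)\boldsymbol{n}_j\big]+\sum_{j=1}^3k_{ij}(\boldsymbol{n}_i\cdot\nabla\times\boldsymbol{n}_j)(\nabla\times\boldsymbol{n}_j).$$ *)

(* Defs.v *)
From HB Require Import structures.
From mathcomp Require Import all_boot all_order all_algebra.
From mathcomp Require Import all_classical all_reals all_analysis.

Set Implicit Arguments.
Unset Strict Implicit.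
Unset Printing Implicit Defensive.

Import Order.TTheory GRing.Theory Num.Theory.
Import numFieldNormedType.Exports.

Local Open Scope classical_set_scope.
Local Open Scope ring_scope.

(* Points of space are row vectors, vector fields are column-valued. *)
Notation scalar_field R := ('rV[R]_3 -> R).
Notation vector_field R := ('rV[R]_3 -> 'cV[R]_3).
Notation matrix_field R := ('rV[R]_3 -> 'M[R]_3).

Section Smoothness.
Context {R : realType} {V W : normedModType R}.

Definition iter_derive (s : seq V) (f : V -> W) : V -> W :=
  foldr (fun v g => 'D_v g) f s.

(* Iterated directional derivatives are used, instead of partial derivatives
   only, so that the same definition serves for fields on space and for fields
   on space-time.  On a finite-dimensional V and an open set U this is the
   existence and continuity on U of the partial derivatives of all orders. *)
Definition smooth_on (U : set V) (f : V -> W) : Prop :=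
  forall (s : seq V) (x : V), U x ->
    {for x, continuous (iter_derive s f)} /\
    (forall v : V, derivable (iter_derive s f) x v).

End Smoothness.

Section VectorCalculus.
Context {R : realType}.
Implicit Types (f : scalar_field R) (v : vector_field R) (T : matrix_field R).

Definition partial (k : 'I_3) f (x : 'rV[R]_3) : R := 'D_(delta_mx 0 k) f x.

Definition grad f : vector_field R := fun x => \col_k partial k f x.

Definition div v : scalar_field R :=
  fun x => \sum_k partial k (fun y => v y k 0) x.

(* Indices live in the ring 'I_3, hence are taken modulo 3. *)
Definition curl v : vector_field R := fun x => \col_(i < 3)
  (partial (i + 1) (fun y => v y (i + 2%:R) 0) x -
   partial (i + 2%:R) (fun y => v y (i + 1) 0) x).

Definition vgrad v : matrix_field R :=
  fun x => \matrix_(k, l) partial k (fun y => v y l 0) x.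

(* Contraction on the first index, the derivation index of [vgrad]. *)
Definition tdiv T : vector_field R :=
  fun x => \col_l \sum_k partial k (fun y => T y k l) x.

Definition laplacian v : vector_field R :=
  fun x => \col_l \sum_k partial k (partial k (fun y => v y l 0)) x.

Definition mxdot m n (A B : 'M[R]_(m, n)) : R := \sum_i \sum_j A i j * B i j.

End VectorCalculus.

Section PeriodicBox.
Context {R : realType}.

Definition point3 (w : R * R * R) : 'rV[R]_3 :=
  \row_(i < 3) nth 0 [:: w.1.1; w.1.2; w.2] i.

(* Volume integral over the box with opposite corners a and b. *)
Definition box_integral (a b : 'rV[R]_3) (f : scalar_field R) : R :=
  let leb := @lebesgue_measure R in
  \int[((leb \x leb) \x leb)%E]_(w in
      (`[a 0 0, b 0 0] `*` `[a 0 1, b 0 1]) `*` `[a 0 2%:R, b 0 2%:R])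
    f (point3 w).

Definition box_periodic (T : Type) (a b : 'rV[R]_3) (f : 'rV[R]_3 -> T) : Prop :=
  forall (k : 'I_3) (x : 'rV[R]_3),
    f (x + (b 0 k - a 0 k) *: delta_mx 0 k) = f x.

Definition SO3 : set 'M[R]_3 := [set A | A^T *m A = 1%:M /\ \det A = 1].

End PeriodicBox.

Section BiaxialEnergy.
Context {R : realType}.
Variables (gamma k : 'I_3 -> R) (kk : 'I_3 -> 'I_3 -> R).

Definition frame (p : matrix_field R) (i : 'I_3) : vector_field R :=
  fun x => col i (p x).

Definition twist (p : matrix_field R) (i j : 'I_3) : scalar_field R :=
  fun x => mxdot (frame p i x) (curl (frame p j) x).

Definition energy_density (p : matrix_field R) : scalar_field R := fun x =>
  2^-1 * (\sum_i gamma i * mxdot (vgrad (frame p i) x) (vgrad (frame p i) x)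
          + \sum_i k i * div (frame p i) x ^+ 2
          + \sum_i \sum_j kk i j * twist p i j x ^+ 2).

Definition biaxial_energy (a b : 'rV[R]_3) (p : matrix_field R) : R :=
  box_integral a b (energy_density p).

Definition variation_col (p : matrix_field R) (i : 'I_3) : vector_field R :=
  fun x =>
    - (gamma i *: laplacian (frame p i) x)
    - k i *: grad (div (frame p i)) x
    + \sum_j kk j i *: curl (fun y => twist p j i y *: frame p j y) x
    + \sum_j kk i j *: (twist p i j x *: curl (frame p j) x).

Definition energy_variation (p : matrix_field R) : matrix_field R :=
  fun x => \matrix_(r, i) variation_col p i x r 0.

(* Here p and q are the fields at the time levels n and n+1. *)
Definition frame_half (p q : matrix_field R) (i : 'I_3) : vector_field R :=
  fun x => 2^-1 *: (frame q i x + frame p i x).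

Definition twist_half (p q : matrix_field R) (i j : 'I_3) : scalar_field R :=
  fun x => 2^-1 * (twist q i j x + twist p i j x).

Definition discrete_col (p q : matrix_field R) (i : 'I_3) : vector_field R :=
  fun x =>
    - (gamma i *: tdiv (vgrad (frame_half p q i)) x)
    - k i *: grad (div (frame_half p q i)) x
    + \sum_j kk j i *:
        curl (fun y => twist_half p q j i y *: frame_half p q j y) x
    + \sum_j kk i j *: (twist_half p q i j x *: curl (frame_half p q j) x).

Definition discrete_gradient (p q : matrix_field R) : matrix_field R :=
  fun x => \matrix_(r, i) discrete_col p q i x r 0.

End BiaxialEnergy.

(* Main.v *)
(** Each term of the energy density is a square (or a norm square), and
    [x^2 - y^2 = 2 ((x + y) / 2) (x - y)] writes its increment as a midpoint
    value times a difference; for the twist terms, [n_i . curl n_j] is itself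
    split by the discrete product rule
    [uv - u'v' = ((u + u') / 2) (v - v') + (u - u') ((v + v') / 2)].
    Integrating by parts (for the pairs div/grad, grad/div and curl/curl) moves
    the derivatives off [p^{n+1} - p^n]; the remainders are spatial derivatives
    of smooth periodic functions, whose integral over the box is zero.

    For the order of accuracy, call a family [A tau] approximating when all its
    spatial derivatives are within [O(tau^2)] of those of a periodic smooth
    space-time function at the midpoint, uniformly in space.  Time averages are
    approximating, and approximating families are stable under sums, products
    and spatial derivatives; the discrete gradient is built from averages by
    these operations in the same way as the variation is built from the
    field. *)
Require Import Defs.
From HB Require Import structures.
From mathcomp Require Import all_boot all_order all_algebra.
From mathcomp Require Import all_classical all_reals all_analysis.
From mathcomp Require Import ring lra.

Set Implicit Arguments.
Unset Strict Implicit.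
Unset Printing Implicit Defensive.

Import Order.TTheory GRing.Theory Num.Theory.
Import numFieldNormedType.Exports.

Local Open Scope classical_set_scope.
Local Open Scope ring_scope.

(** * Measurability and vanishing integrals on product spaces *)

(* Carathéodory: [f (x, r)] is the limit of [f (x, floor (n r) / n)], and each
   approximant is measurable on countably many strips. *)
Lemma measurable_fun_prod_continuous d (R : realType) (X : measurableType d)
    (f : X * measurableTypeR R -> R) :
  (forall r, measurable_fun setT (fun x => f (x, r))) ->
  (forall x, continuous (fun r : R => f (x, r))) ->
  measurable_fun setT f.
Proof.
move=> mf cf.
(* The grid of step [1 / (n + 1)] approximates [r] from below with an error of at most [harmonic n];
   indexing by [n.+1] keeps the denominator nonzero. *)
pose u n (r : R) : R := (Num.floor (r * n.+1%:R))%:~R / n.+1%:R.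
have u_cvg r : u n r @[n --> \oo] --> r.
  have lo n : r - harmonic n <= u n r.
    rewrite /u /harmonic/= ler_pdivlMr// mulrBl mulVf ?pnatr_eq0//.
    rewrite lerBlDr; apply/ltW; have := floorD1_gt (r * n.+1%:R).
    by rewrite intrD.
  have hi n : u n r <= r by rewrite /u ler_pdivrMr// floor_le.
  apply: (@squeeze_cvgr _ _ _ _ (fun n => r - harmonic n) (cst r)).
  - by near=> n; rewrite lo hi.
  - rewrite -[X in _ --> X]subr0; apply: cvgB; first exact: cvg_cst.
    exact: cvg_harmonic.
  - exact: cvg_cst.
apply: (@measurable_realfun.measurable_fun_cvg _ _ _ _
  (fun n w => f (w.1, u n w.2))); last first.
  by move=> -[x r] _ /=; exact: (cvg_comp _ _ (u_cvg r) (cf x r)).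
move=> n _ B mB; rewrite setTI.
rewrite (_ : _ @^-1` _ = \bigcup_(m : int)
  (((fun x => f (x, m%:~R / n.+1%:R)) @^-1` B) `*`
   `[m%:~R / n.+1%:R, (m + 1)%:~R / n.+1%:R[)); last first.
  apply/seteqP; split => [[x r] /= Bxr|[x r] [m _ /= [Bx]]].
    exists (Num.floor (r * n.+1%:R)) => //=; split => //.
    rewrite in_itv/= ler_pdivrMr// ltr_pdivlMr//.
    exact: floor_itv.
  rewrite in_itv/= ler_pdivrMr// ltr_pdivlMr// => /floor_def fl.
  by rewrite /u fl.
apply: countable_bigcupT_measurable => [|m]; first exact: countableP.
apply: measurableX; last exact: measurable_itv.
by rewrite -[_ @^-1` _]setTI; exact: mf.
Unshelve. all: by end_near. Qed.

Lemma product_measure1_lty d1 d2 (T1 : measurableType d1)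
    (T2 : measurableType d2) (R : realType)
    (m1 : {measure set T1 -> \bar R})
    (m2 : {sigma_finite_measure set T2 -> \bar R}) (A : set T1) (B : set T2) :
  measurable A -> measurable B -> (m1 A < +oo)%E -> (m2 B < +oo)%E ->
  ((m1 \x m2)%E (A `*` B) < +oo)%E.
Proof.
move=> mA mB Aoo Boo; rewrite product_measure1E//.
by rewrite lte_mul_pinfty// ge0_fin_numE.
Qed.

Lemma lebesgue_segment_lty (R : realType) (l u : R) :
  (@lebesgue_measure R `[l, u] < +oo)%E.
Proof. by apply: compact_finite_measure; exact: segment_compact. Qed.

(* The library's sigma-finite instance on [m1 \x m2] is shadowed by the one for
   subprobabilities, hence this alias. *)
Definition lebesgue_measure2 (R : realType) :=
  (@lebesgue_measure R \x @lebesgue_measure R)%E.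

Lemma sigma_finite_lebesgue_measure2 (R : realType) :
  sigma_finite setT (@lebesgue_measure2 R).
Proof.
exists (fun n => `[- n%:R, n%:R] `*` `[- n%:R, n%:R]) => [|n].
  apply/esym/seteqP; split => // -[x y] _.
  exists (maxn (Num.bound `|x|) (Num.bound `|y|)) => //=.
  have bnd (z : R) n : (Num.bound `|z| <= n)%N -> - n%:R <= z <= n%:R.
    move=> zn; rewrite -ler_norml; apply/ltW.
    apply: lt_le_trans (archi_boundP (normr_ge0 z)) _.
    by rewrite ler_nat.
  by split; rewrite in_itv/= bnd// ?leq_maxl ?leq_maxr.
split; first by apply: measurableX; exact: measurable_itv.
apply: product_measure1_lty; do ?exact: lebesgue_segment_lty;
  exact: measurable_itv.
Qed.

HB.instance Definition _ (R : realType) := Measure.on (@lebesgue_measure2 R).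

HB.instance Definition _ (R : realType) :=
  @Measure_isSigmaFinite.Build _ _ R (@lebesgue_measure2 R)
    (@sigma_finite_lebesgue_measure2 R).

(** Fubini: the two alternatives are the two orders of integration, and in one of them every inner
    integral vanishes. *)
Lemma integral_prod_eq0 d1 d2 (T1 : measurableType d1)
    (T2 : measurableType d2) (R : realType)
    (m1 : {sigma_finite_measure set T1 -> \bar R})
    (m2 : {sigma_finite_measure set T2 -> \bar R}) (A : set T1) (B : set T2)
    (f : T1 * T2 -> R) :
  measurable A -> measurable B ->
  (m1 \x m2)%E.-integrable (A `*` B) (EFin \o f) ->
  (forall x, A x -> \int[m2]_(y in B) (f (x, y))%:E = 0)%E \/
  (forall y, B y -> \int[m1]_(x in A) (f (x, y))%:E = 0)%E ->
  (\int[(m1 \x m2)%E]_(z in A `*` B) (f z)%:E = 0)%E.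
Proof.
(* Fubini is applied on the whole product space, to the integrand extended by zero outside the
   rectangle. *)
move=> mA mB /integrable_mkcond - /(_ (measurableX mA mB)) fi f0.
rewrite integral_mkcond.
case: f0 => f0.
  rewrite -(integral12_prod_meas1 fi); apply: integral0_eq => x _.
  rewrite /fubini_F; have [Ax|nAx] := pselect (A x).
    rewrite -[RHS](f0 x Ax) [RHS]integral_mkcond; apply: eq_integral => y _.
    rewrite /patch /=; congr (if _ then _ else _).
    by apply/idP/idP; rewrite !inE/= => // -[].
  apply: integral0_eq => y _; rewrite /patch memNset//.
  by move=> -[].
rewrite -(integral21_prod_meas1 fi); apply: integral0_eq => y _.
rewrite /fubini_G; have [By|nBy] := pselect (B y).
  rewrite -[RHS](f0 y By) [RHS]integral_mkcond; apply: eq_integral => x _.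
  rewrite /patch /=; congr (if _ then _ else _).
  by apply/idP/idP; rewrite !inE/= => // -[].
by apply: integral0_eq => x _; rewrite /patch memNset// => -[].
Qed.

(** * Continuity of pairs and derivatives along lines *)

Lemma continuous_at_pair (U V W : topologicalType) (f : U -> V) (g : U -> W)
    (x : U) :
  {for x, continuous f} -> {for x, continuous g} ->
  {for x, continuous (fun u => (f u, g u))}.
Proof.
by move=> cf cg; apply: (@cvg_pair _ _ _ (nbhs x) (nbhs (f x)) (nbhs (g x))).
Qed.

(** The difference quotients of both sides are the same function of [h], so the derivative is read
    off directly, without the chain rule. *)
Lemma is_derive_line (R : realType) (V : normedModType R) (f : V -> R)
    (x v : V) (s : R) :
  derivable f (x + s *: v) v ->
  is_derive s 1 (fun t : R => f (x + t *: v)) ('D_v f (x + s *: v)).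
Proof.
move=> df.
have E : (fun h : R => h^-1 *: ((fun t : R => f (x + t *: v)) (h *: 1 + s) -
                                f (x + s *: v))) =
         (fun h => h^-1 *: (f (h *: v + (x + s *: v)) - f (x + s *: v))).
  apply/funext => h /=; congr (_ *: (f _ - _)).
  by rewrite [h *: 1]mulr1 scalerDl addrCA.
apply: DeriveDef; first by rewrite /derivable E.
by rewrite /derive E.
Qed.

Lemma ord3_cases (k : 'I_3) : k = 0 \/ k = 1 \/ k = 2%:R.
Proof.
by case: k => -[|[|[|//]]] Hk; [left|right; left|right; right]; exact/val_inj.
Qed.

(** * Integration over the box and the fundamental theorem of calculus *)

Section BoxIntegral.
Context {R : realType}.
Implicit Types (a b : 'rV[R]_3) (f g : scalar_field R).

Local Notation leb := (@lebesgue_measure R).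

Definition box a b : set (R * R * R) :=
  (`[a 0 0, b 0 0] `*` `[a 0 1, b 0 1]) `*` `[a 0 2%:R, b 0 2%:R].

Lemma box_measurable a b : measurable (box a b :
  set (measurableTypeR R * measurableTypeR R * measurableTypeR R)).
Proof. by apply: measurableX; [apply: measurableX|]; exact: measurable_itv. Qed.

Lemma box_finite a b : (((leb \x leb) \x leb)%E (box a b) < +oo)%E.
Proof.
have mI (l u : R) : measurable (`[l, u] : set (measurableTypeR R)).
  exact: measurable_itv.
by apply: product_measure1_lty => //; try apply: product_measure1_lty => //;
  [exact: measurableX|exact: lebesgue_segment_lty..].
Qed.

Lemma point3E (w : R * R * R) :
  point3 w = w.1.1 *: delta_mx 0 0 + w.1.2 *: delta_mx 0 1 +
             w.2 *: delta_mx 0 2%:R.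
Proof.
apply/rowP => i; rewrite !mxE/=.
by case: i => -[|[|[|//]]] Hi; rewrite /= ?mulr1 ?mulr0 ?addr0 ?add0r.
Qed.

Lemma continuous_point3 : continuous (@point3 R).
Proof.
move=> w; rewrite (_ : @point3 R = fun w => w.1.1 *: delta_mx 0 0 +
    w.1.2 *: delta_mx 0 1 + w.2 *: delta_mx 0 2%:R); last first.
  by apply/funext => z; exact: point3E.
apply: cvgD; first apply: cvgD; apply: cvgZr_tmp.
- by apply: (cvg_comp _ _ (@cvg_fst _ _ _ _ _) _); exact: cvg_fst.
- by apply: (cvg_comp _ _ (@cvg_fst _ _ _ _ _) _); exact: cvg_snd.
- exact: cvg_snd.
Qed.

Lemma continuous_bounded_on (X : topologicalType) (K : set X) (g : X -> R) :
  compact K -> continuous g -> [bounded g x | x in K].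
Proof.
move=> cK /continuous_subspaceT cg.
have /compact_bounded[M [_ mrt]] := continuous_compact (cg K) cK.
exists M; split; rewrite ?num_real // => r Mr x Kx.
by apply: mrt => //; exists x.
Qed.

Lemma continuous_pairl (U V : topologicalType) (v : V) :
  continuous (fun u : U => (u, v)).
Proof.
by move=> u; apply: continuous_at_pair; [exact: cvg_id|exact: cvg_cst].
Qed.

Lemma continuous_pairr (U V : topologicalType) (u : U) :
  continuous (fun v : V => (u, v)).
Proof.
by move=> v; apply: continuous_at_pair; [exact: cvg_cst|exact: cvg_id].
Qed.

Lemma continuous_comp2 (U V W : topologicalType) (u : U -> V) (v : V -> W) :
  continuous u -> continuous v -> continuous (fun t => v (u t)).
Proof. by move=> cu cv t; exact: (continuous_comp (cu t) (cv _)). Qed.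

(** Measurability is for the product sigma-algebra; it follows from continuity in each variable by
    the Carathéodory argument above. *)
Lemma continuous_measurable_prod2 (g : R * R -> R) : continuous g ->
  measurable_fun (setT : set (measurableTypeR R * measurableTypeR R)) g.
Proof.
move=> cg; apply: measurable_fun_prod_continuous => [y|x].
  apply: measurable_realfun.continuous_measurable_fun.
  exact: (continuous_comp2 (@continuous_pairl R R y) cg).
exact: (continuous_comp2 (@continuous_pairr R R x) cg).
Qed.

Lemma continuous_measurable_prod3 (g : R * R * R -> R) : continuous g ->
  measurable_fun
    (setT : set (measurableTypeR R * measurableTypeR R * measurableTypeR R)) g.
Proof.
move=> cg; apply: measurable_fun_prod_continuous => [z|x].
  apply: continuous_measurable_prod2.
  exact: (continuous_comp2 (@continuous_pairl (R * R)%type R z) cg).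
exact: (continuous_comp2 (@continuous_pairr (R * R)%type R x) cg).
Qed.

Lemma continuous_rectangle_integrable (l u l' u' : R) (g : R * R -> R) :
  continuous g ->
  (leb \x leb)%E.-integrable (`[l, u] `*` `[l', u']) (EFin \o g).
Proof.
move=> cg; apply: measurable_bounded_integrable.
- by apply: measurableX; exact: measurable_itv.
- apply: product_measure1_lty; do ?exact: lebesgue_segment_lty;
    exact: measurable_itv.
- by apply: measurable_funTS; exact: continuous_measurable_prod2.
- apply: continuous_bounded_on => //.
  by apply: compact_setX; exact: segment_compact.
Qed.

Lemma continuous_box_integrable a b f : continuous f ->
  ((leb \x leb) \x leb)%E.-integrable (box a b) (EFin \o (f \o @point3 R)).
Proof.
move=> cf; have cfp := continuous_comp2 continuous_point3 cf.
apply: measurable_bounded_integrable.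
- exact: box_measurable.
- exact: box_finite.
- by apply: measurable_funTS; exact: continuous_measurable_prod3.
- apply: continuous_bounded_on => //.
  by do 2?apply: compact_setX; exact: segment_compact.
Qed.

Lemma integral_partial_line (k : 'I_3) f (x : 'rV[R]_3) (l u : R) : l < u ->
  (forall y, derivable f y (delta_mx 0 k)) -> continuous (partial k f) ->
  (\int[leb]_(s in `[l, u]) (partial k f (x + s *: delta_mx 0 k))%:E =
   (f (x + u *: delta_mx 0 k) - f (x + l *: delta_mx 0 k))%:E)%E.
Proof.
move=> lu df cf.
have dfl (s : R) : is_derive s 1 (fun t => f (x + t *: delta_mx 0 k))
    (partial k f (x + s *: delta_mx 0 k)) by exact: is_derive_line.
have cfl : continuous (fun t : R => f (x + t *: delta_mx 0 k)).
  move=> s; apply: differentiable_continuous; apply/derivable1_diffP.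
  exact: (@ex_derive _ _ _ _ _ _ _ (dfl s)).
have cline : continuous (fun t : R => x + t *: delta_mx 0 k).
  by move=> s; apply: cvgD; [exact: cvg_cst|apply: cvgZr_tmp; exact: cvg_id].
rewrite (continuous_FTC2 (F := fun t => f (x + t *: delta_mx 0 k))) ?EFinB//.
- apply: continuous_subspaceT => s.
  by apply: continuous_comp; [exact: cline|exact: cf].
- split; last 2 first.
  + exact/cvg_at_right_filter/cfl.
  + exact/cvg_at_left_filter/cfl.
  + by move=> s _; exact: (@ex_derive _ _ _ _ _ _ _ (dfl s)).
- by move=> s _; rewrite derive1E; exact: (@derive_val _ _ _ _ _ _ _ (dfl s)).
Qed.

(** Integrating first in the direction [k] leaves the difference of the values of [f] on two
    opposite faces, which is zero by periodicity; Fubini handles the other directions. *)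
Lemma box_integral_partial_eq0 a b (k : 'I_3) f : (forall l, a 0 l < b 0 l) ->
  (forall y, derivable f y (delta_mx 0 k)) -> continuous (partial k f) ->
  box_periodic a b f -> box_integral a b (partial k f) = 0.
Proof.
move=> ab df cf pf.
have line (x : 'rV[R]_3) : (\int[leb]_(s in `[a 0%R k, b 0%R k])
    (partial k f (x + s *: delta_mx 0 k))%:E = 0)%E.
  (* Here [pf] moves the lower end [a 0 k] forward by one period, onto the upper end [b 0 k]. *)
  rewrite integral_partial_line// -(pf k (x + a 0 k *: _)) -addrA -scalerDl.
  by rewrite [a 0 k + _]addrC subrK subrr.
have fi := continuous_box_integrable a b cf.
rewrite /box_integral /Rintegral; apply/(congr1 fine (y := 0%E)).
have mI l u : measurable (`[l, u] : set (measurableTypeR R)).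
  exact: measurable_itv.
(* Naming the measure [lebesgue_measure2] selects its sigma-finite structure; it unfolds to the
   product measure of [box_integral]. *)
have key := @integral_prod_eq0 _ _ _ _ R (@lebesgue_measure2 R) leb
  (`[a 0 0, b 0 0] `*` `[a 0 1, b 0 1]) `[a 0 2%:R, b 0 2%:R]
  (partial k f \o @point3 R) (measurableX (mI _ _) (mI _ _)) (mI _ _) fi.
apply: key.
(* For [k = 0] or [k = 1] the direction lies in the first factor of the product, so Fubini is
   applied a second time, at fixed height [z]. *)
have rect z (g := fun w : R * R => partial k f (point3 (w, z))) :
    ((forall x, `[a 0%R 0%R, b 0%R 0%R]%classic x ->
        \int[leb]_(y in `[a 0%R 1%R, b 0%R 1%R]) (g (x, y))%:E = 0) \/
     (forall y, `[a 0%R 1%R, b 0%R 1%R]%classic y ->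
        \int[leb]_(x in `[a 0%R 0%R, b 0%R 0%R]) (g (x, y))%:E = 0) ->
    \int[(leb \x leb)%E]_(w in `[a 0%R 0%R, b 0%R 0%R] `*`
                              `[a 0%R 1%R, b 0%R 1%R]) (g w)%:E = 0)%E.
  move=> g0; have cg : continuous g.
    exact: (continuous_comp2 (@continuous_pairl (R * R)%type R z)
              (continuous_comp2 continuous_point3 cf)).
  exact: (@integral_prod_eq0 _ _ _ _ R leb leb _ _ _ (mI _ _) (mI _ _)
            (continuous_rectangle_integrable _ _ _ _ cg) g0).
(* The base point is zero in the direction of integration, so that the integration variable becomes
   the parameter of a coordinate line. *)
have shift0 (s y z : R) :
    point3 (s, y, z) = point3 (0, y, z) + s *: delta_mx 0 0.
  by rewrite !point3E/= scale0r add0r -addrA addrC.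
have shift1 (x s z : R) :
    point3 (x, s, z) = point3 (x, 0, z) + s *: delta_mx 0 1.
  by rewrite !point3E/= scale0r addr0 addrAC.
have shift2 (x y s : R) :
    point3 (x, y, s) = point3 (x, y, 0) + s *: delta_mx 0 2%:R.
  by rewrite !point3E/= scale0r addr0.
have [k0|[k1|k2]] := ord3_cases k.
- right => z _; apply: rect; right => y _; move: line; rewrite k0 => line.
  rewrite -[RHS](line (point3 (0, y, z))).
  by under eq_integral do rewrite shift0.
- right => z _; apply: rect; left => x _; move: line; rewrite k1 => line.
  rewrite -[RHS](line (point3 (x, 0, z))).
  by under eq_integral do rewrite shift1.
- left => -[x y] _; move: line; rewrite k2 => line.
  rewrite -[RHS](line (point3 (x, y, 0))).
  by under eq_integral do rewrite /= shift2.
Qed.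

End BoxIntegral.

(** * Scalar functions smooth on an open set *)

Lemma open_cylinder (T1 T2 : topologicalType) (A : set T1) : open A ->
  open (A `*` [set: T2]).
Proof.
move=> oA; rewrite (_ : _ `*` _ = fst @^-1` A).
  by apply: open_comp => // z _; exact: cvg_fst.
by apply/seteqP; split => -[x y] //= [].
Qed.

Section SmoothFunctions.
Context {R : realType} {V : normedModType R} (U : set V).
Hypothesis oU : open U.
Implicit Types (f g : V -> R) (n : nat).

(** Finite-order form of [smooth_on] for real-valued functions. Recursion on the order lets closure
    under sums and products be shown by induction, one derivative at a time. *)
Fixpoint Ck n f : Prop :=
  (forall x, U x -> {for x, continuous f}) /\
  if n is m.+1 then forall v,
    (forall x, U x -> derivable f x v) /\ Ck m ('D_v f)
  else True.

Lemma near_eq_on f g x : (forall y, U y -> f y = g y) -> U x ->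
  \near x, f x = g x.
Proof.
move=> fg Ux; have := open_nbhs_nbhs (conj oU Ux).
by apply: filterS => y; exact: fg.
Qed.

Lemma derive_eq_on f g x v : (forall y, U y -> f y = g y) -> U x ->
  'D_v f x = 'D_v g x.
Proof. by move=> fg Ux; apply: near_eq_derive; exact: near_eq_on. Qed.

Lemma continuous_eq_on f g x : (forall y, U y -> f y = g y) -> U x ->
  {for x, continuous f} -> {for x, continuous g}.
Proof.
move=> fg Ux cf; rewrite /prop_for /continuous_at -(fg _ Ux).
by apply: cvg_trans cf; apply: near_eq_cvg; exact: near_eq_on.
Qed.

(** As [U] is open, functions equal on [U] agree near each of its points, hence so do their
    derivatives of every order. *)
Lemma eq_Ck n f g : (forall x, U x -> f x = g x) -> Ck n f -> Ck n g.
Proof.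
elim: n f g => [|n IHn] f g fg [cf df].
  by split=> // x Ux; exact: continuous_eq_on (cf x Ux).
split=> [x Ux|v]; first exact: continuous_eq_on (cf x Ux).
have [dfv Cfv] := df v; split=> [x Ux|].
  by apply: near_eq_derivable (dfv x Ux); exact: near_eq_on.
by apply: IHn Cfv => x Ux; exact: derive_eq_on.
Qed.

Lemma CkW n f : Ck n.+1 f -> Ck n f.
Proof.
elim: n f => [|n IHn] f [cf df]; split=> // v.
by have [? ?] := df v; split=> //; exact: IHn.
Qed.

Lemma Ck_cst n (c : R) : Ck n (fun=> c).
Proof.
elim: n c => [|n IHn] c; split=> //; try by move=> x _; exact: cvg_cst.
move=> v; split=> [x _|]; first exact: derivable_cst.
by apply: eq_Ck (IHn 0) => x _; rewrite derive_cst.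
Qed.

Lemma CkD n f g : Ck n f -> Ck n g -> Ck n (fun x => f x + g x).
Proof.
elim: n f g => [|n IHn] f g [cf df] [cg dg].
  by split=> // x Ux; apply: cvgD; [exact: cf|exact: cg].
split=> [x Ux|v]; first by apply: cvgD; [exact: cf|exact: cg].
have [dfv Cf] := df v; have [dgv Cg] := dg v; split=> [x Ux|].
  by apply: derivableD; [exact: dfv|exact: dgv].
apply: eq_Ck (IHn _ _ Cf Cg) => x Ux.
by rewrite -deriveD; [|exact: dfv|exact: dgv].
Qed.

Lemma CkM n f g : Ck n f -> Ck n g -> Ck n (fun x => f x * g x).
Proof.
elim: n f g => [|n IHn] f g Cf Cg; move: (Cf) (Cg) => [cf df] [cg dg].
  by split=> // x Ux; apply: cvgM; [exact: cf|exact: cg].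
split=> [x Ux|v]; first by apply: cvgM; [exact: cf|exact: cg].
have [dfv Cfv] := df v; have [dgv Cgv] := dg v; split=> [x Ux|].
  by apply: derivableM; [exact: dfv|exact: dgv].
(* Leibniz rule: each product has one factor differentiated, of order [n], and one left as it is,
   whose order [CkW] lowers to [n]. *)
apply: eq_Ck (CkD (IHn _ _ (CkW Cf) Cgv) (IHn _ _ (CkW Cg) Cfv)) => x Ux.
by rewrite -[LHS]/(f x *: 'D_v g x + g x *: 'D_v f x) -deriveM;
  [|exact: dfv|exact: dgv].
Qed.

Definition smooth f := forall n, Ck n f.

Lemma smooth_cst (c : R) : smooth (fun=> c).
Proof. by move=> n; exact: Ck_cst. Qed.

Lemma smoothD f g : smooth f -> smooth g -> smooth (fun x => f x + g x).
Proof. by move=> sf sg n; exact: CkD. Qed.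

Lemma smoothM f g : smooth f -> smooth g -> smooth (fun x => f x * g x).
Proof. by move=> sf sg n; exact: CkM. Qed.

Lemma smooth_derive f v : smooth f -> smooth ('D_v f).
Proof. by move=> sf n; have [_ /(_ v)[]] := sf n.+1. Qed.

Lemma smooth_continuous f x : smooth f -> U x -> {for x, continuous f}.
Proof. by move=> /(_ 0%N)[cf _]; exact: cf. Qed.

Lemma smooth_derivable f x v : smooth f -> U x -> derivable f x v.
Proof. by move=> /(_ 1%N)[_ /(_ v)[df _]]; exact: df. Qed.

Lemma smooth_on_entry m n (M : V -> 'M[R]_(m, n)) i j :
  smooth_on U M -> smooth (fun x => M x i j).
Proof.
move=> sM.
(* The claim is generalized to all iterated derivatives of [M], so that differentiating an entry
   only lengthens the list [s]. *)
suff entry k s : Ck k (fun x => iter_derive s M x i j).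
  by move=> k; exact: (entry k [::]).
elim: k s => [|k IHk] s.
  split=> // x Ux; have [cM _] := sM s x Ux.
  exact: (continuous_comp cM (@coord_continuous _ _ _ i j _)).
split=> [x Ux|v].
  have [cM _] := sM s x Ux.
  exact: (continuous_comp cM (@coord_continuous _ _ _ i j _)).
split=> [x Ux|].
  by have [_ /(_ v)/derivable_mxP] := sM s x Ux; exact.
apply: eq_Ck (IHk (v :: s)) => x Ux /=.
have [_ /(_ v) dM] := sM s x Ux.
by rewrite derive_mx// mxE.
Qed.

End SmoothFunctions.

(** * Periodic smooth fields and integration by parts *)

Section PeriodicFields.
Context {R : realType} (a b : 'rV[R]_3).
Implicit Types (f g : scalar_field R) (u v w : vector_field R).

Definition periodic_smooth f := smooth setT f /\ box_periodic a b f.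

Lemma periodic_smooth_cst (c : R) : periodic_smooth (fun=> c).
Proof. by split=> //; exact: smooth_cst openT c. Qed.

Lemma periodic_smoothD f g : periodic_smooth f -> periodic_smooth g ->
  periodic_smooth (fun x => f x + g x).
Proof.
move=> [sf pf] [sg pg]; split; first exact: smoothD openT _ _ sf sg.
by move=> k x; rewrite pf pg.
Qed.

Lemma periodic_smoothM f g : periodic_smooth f -> periodic_smooth g ->
  periodic_smooth (fun x => f x * g x).
Proof.
move=> [sf pf] [sg pg]; split; first exact: smoothM openT _ _ sf sg.
by move=> k x; rewrite pf pg.
Qed.

Lemma periodic_smoothZ (c : R) f : periodic_smooth f ->
  periodic_smooth (fun x => c * f x).
Proof. exact: periodic_smoothM (periodic_smooth_cst c). Qed.

Lemma periodic_smoothB f g : periodic_smooth f -> periodic_smooth g ->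
  periodic_smooth (fun x => f x - g x).
Proof.
move=> sf /(periodic_smoothZ (-1)) /(periodic_smoothD sf).
by under eq_fun do rewrite mulN1r.
Qed.

Lemma periodic_smooth_sum (I : Type) (r : seq I) (F : I -> scalar_field R) :
  (forall i, periodic_smooth (F i)) ->
  periodic_smooth (fun x => \sum_(i <- r) F i x).
Proof.
move=> sF; elim: r => [|i r IHr].
  by under eq_fun do rewrite big_nil; exact: periodic_smooth_cst.
by under eq_fun do rewrite big_cons; exact: periodic_smoothD.
Qed.

Lemma periodic_smooth_partial k f : periodic_smooth f ->
  periodic_smooth (partial k f).
Proof.
move=> [sf pf]; split; first exact: smooth_derive.
(* The difference quotients at [x] and at its translate are the same function of [h], so they have
   the same limit. *)
move=> l x; apply: (congr1 (fun G : R -> R => lim (G h @[h --> 0^']))).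
apply/funext => h /=.
by rewrite addrA !pf.
Qed.

Lemma periodic_smooth_derivable f (x e : 'rV[R]_3) :
  periodic_smooth f -> derivable f x e.
Proof. by move=> [sf _]; exact: smooth_derivable. Qed.

Lemma periodic_smooth_continuous f : periodic_smooth f -> continuous f.
Proof. by move=> [sf _] x; exact: smooth_continuous. Qed.

Lemma partialD k f g x : periodic_smooth f -> periodic_smooth g ->
  partial k (fun y => f y + g y) x = partial k f x + partial k g x.
Proof.
by move=> sf sg; rewrite /partial deriveD//; exact: periodic_smooth_derivable.
Qed.

Lemma partialB k f g x : periodic_smooth f -> periodic_smooth g ->
  partial k (fun y => f y - g y) x = partial k f x - partial k g x.
Proof.
by move=> sf sg; rewrite /partial deriveB//; exact: periodic_smooth_derivable.
Qed.

Lemma partialM k f g x : periodic_smooth f -> periodic_smooth g ->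
  partial k (fun y => f y * g y) x = partial k f x * g x + f x * partial k g x.
Proof.
move=> sf sg; rewrite /partial deriveM; [|exact: periodic_smooth_derivable..].
by rewrite addrC [in LHS]/GRing.scale/= [g x * _]mulrC.
Qed.

Lemma partialZ k c f x : periodic_smooth f ->
  partial k (fun y => c * f y) x = c * partial k f x.
Proof.
by move=> sf; rewrite /partial deriveZ//; exact: periodic_smooth_derivable.
Qed.

Hypothesis ab : forall l, a 0 l < b 0 l.

Lemma box_integralD f g : continuous f -> continuous g ->
  box_integral a b (fun x => f x + g x) =
  box_integral a b f + box_integral a b g.
Proof.
move=> cf cg; exact: (RintegralD (@box_measurable R a b)
  (continuous_box_integrable a b cf) (continuous_box_integrable a b cg)).
Qed.

Lemma box_integralZ c f : continuous f ->
  box_integral a b (fun x => c * f x) = c * box_integral a b f.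
Proof.
move=> cf; exact: (RintegralZl c (@box_measurable R a b)
  (continuous_box_integrable a b cf)).
Qed.

(** The remainders of the integrations by parts are of this kind. Smoothness is kept along with the
    vanishing integral, since additivity of the integral relies on it. *)
Definition null f := periodic_smooth f /\ box_integral a b f = 0.

Lemma nullD f g : null f -> null g -> null (fun x => f x + g x).
Proof.
move=> [sf f0] [sg g0]; split; first exact: periodic_smoothD.
by rewrite box_integralD ?f0 ?g0 ?addr0//; exact: periodic_smooth_continuous.
Qed.

Lemma nullZ c f : null f -> null (fun x => c * f x).
Proof.
move=> [sf f0]; split; first exact: periodic_smoothZ.
by rewrite box_integralZ ?f0 ?mulr0//; exact: periodic_smooth_continuous.
Qed.

Lemma null_sum (I : Type) (r : seq I) (F : I -> scalar_field R) :
  (forall i, null (F i)) -> null (fun x => \sum_(i <- r) F i x).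
Proof.
move=> nF; elim: r => [|i r IHr]; last first.
  by under eq_fun do rewrite big_cons; exact: nullD.
under eq_fun do rewrite big_nil.
have s0 := periodic_smooth_cst 0; split=> //.
by have := box_integralZ 0 (periodic_smooth_continuous s0); rewrite !mul0r.
Qed.

Lemma null_partial k f : periodic_smooth f -> null (partial k f).
Proof.
move=> sf; have sdf := periodic_smooth_partial k sf; split=> //.
apply: box_integral_partial_eq0 => //.
- by move=> y; exact: periodic_smooth_derivable.
- exact: periodic_smooth_continuous.
- by case: sf.
Qed.

Definition periodic_smooth_vector u :=
  forall r, periodic_smooth (fun x => u x r 0).

Lemma mxdot_col m (A B : 'cV[R]_m) : mxdot A B = \sum_i A i 0 * B i 0.
Proof. by apply: eq_bigr => i _; rewrite big_ord1. Qed.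

(** Pointwise, the sum is the divergence of the field with components [\sum_l (d_k u_l) v_l]. *)
Lemma null_tdiv_vgrad u v : periodic_smooth_vector u ->
  periodic_smooth_vector v ->
  null (fun x => mxdot (tdiv (vgrad u) x) (v x) +
                 mxdot (vgrad u x) (vgrad v x)).
Proof.
move=> su sv.
rewrite (_ : (fun x => _) = (fun x => \sum_l \sum_k
    partial k (fun y => partial k (fun z => u z l 0) y * v y l 0) x)).
  apply: null_sum => l; apply: null_sum => k; apply: null_partial.
  by apply: periodic_smoothM; [exact: periodic_smooth_partial|].
apply/funext => x; rewrite mxdot_col /mxdot [in X in _ + X]exchange_big.
rewrite -big_split.
apply: eq_bigr => l _ /=; rewrite mxE mulr_suml -big_split.
apply: eq_bigr => k _ /=.
rewrite partialM//; last exact: periodic_smooth_partial.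
congr (partial k _ x * _ + _); first by apply/funext => y; rewrite mxE.
by rewrite !mxE.
Qed.

Lemma periodic_smooth_div u :
  periodic_smooth_vector u -> periodic_smooth (div u).
Proof.
by move=> su; apply: periodic_smooth_sum => k; exact: periodic_smooth_partial.
Qed.

(** Pointwise, the sum is the divergence of [(div u) v]. *)
Lemma null_grad_div u v :
  periodic_smooth_vector u -> periodic_smooth_vector v ->
  null (fun x => mxdot (grad (div u) x) (v x) + div u x * div v x).
Proof.
move=> su sv; have sdu := periodic_smooth_div su.
rewrite (_ : (fun x => _) = (fun x => \sum_k
    partial k (fun y => div u y * v y k 0) x)).
  by apply: null_sum => k; apply: null_partial; exact: periodic_smoothM.
apply/funext => x; rewrite mxdot_col mulr_sumr -big_split.
apply: eq_bigr => k _ /=.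
by rewrite partialM// mxE.
Qed.

Lemma sum_ord3 (F : 'I_3 -> R) : \sum_i F i = F 0 + F 1 + F 2%:R.
Proof.
rewrite !big_ord_recl big_ord0 addr0 addrA.
by congr (F _ + F _ + F _); exact/val_inj.
Qed.

(** Pointwise, the difference is the divergence of the cross product of [w] and [v], with its six
    terms grouped by the component of [v]. *)
Lemma null_curl w v : periodic_smooth_vector w -> periodic_smooth_vector v ->
  null (fun x => mxdot (curl w x) (v x) - mxdot (w x) (curl v x)).
Proof.
move=> sw sv.
rewrite (_ : (fun x => _) = (fun x => \sum_i
    (partial (i + 1) (fun y => w y (i + 2%:R) 0 * v y i 0) x +
     (-1) * partial (i + 2%:R) (fun y => w y (i + 1) 0 * v y i 0) x))).
  apply: null_sum => i; apply: nullD; last apply: nullZ; apply: null_partial;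
    exact: periodic_smoothM.
have e01 : (1 + 1 = 2%:R :> 'I_3) by [].
have e12 : (1 + 2%:R = 0 :> 'I_3) by exact/val_inj.
have e21 : (2%:R + 1 = 0 :> 'I_3) by exact/val_inj.
have e22 : (2%:R + 2%:R = 1 :> 'I_3) by exact/val_inj.
apply/funext => x; rewrite !mxdot_col.
under [X in X - _]eq_bigr do rewrite mxE.
under [X in _ - X]eq_bigr do rewrite mxE.
under [RHS]eq_bigr do rewrite !partialM//.
rewrite !sum_ord3 !add0r !(e01, e12, e21, e22); ring.
Qed.

End PeriodicFields.

(** * The energy difference relation *)

Section EnergyDifference.
Context {R : realType} (a b : 'rV[R]_3).
Hypothesis ab : forall l, a 0 l < b 0 l.
Implicit Types (u v w : vector_field R) (p q : matrix_field R).

Local Notation psv := (periodic_smooth_vector a b).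

Lemma periodic_smooth_curl u : psv u -> psv (curl u).
Proof.
move=> su i; under eq_fun do rewrite mxE.
by apply: periodic_smoothB; exact: periodic_smooth_partial.
Qed.

Lemma periodic_smooth_mxdot u v : psv u -> psv v ->
  periodic_smooth a b (fun x => mxdot (u x) (v x)).
Proof.
move=> su sv; under eq_fun do rewrite mxdot_col.
by apply: periodic_smooth_sum => i; exact: periodic_smoothM.
Qed.

Lemma periodic_smooth_scale f u : periodic_smooth a b f -> psv u ->
  psv (fun x => f x *: u x).
Proof.
by move=> sf su i; under eq_fun do rewrite mxE; exact: periodic_smoothM.
Qed.

(** With the new time level as [u] and the old one as [v], this is [frame_half] by conversion. *)
Definition mean_field u v : vector_field R := fun x => 2^-1 *: (u x + v x).
Definition diff_field u v : vector_field R := fun x => u x - v x.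

Lemma periodic_smooth_mean u v : psv u -> psv v -> psv (mean_field u v).
Proof.
move=> su sv i; under eq_fun do rewrite !mxE.
by apply: periodic_smoothZ; exact: periodic_smoothD.
Qed.

Lemma periodic_smooth_diff u v : psv u -> psv v -> psv (diff_field u v).
Proof.
by move=> su sv i; under eq_fun do rewrite !mxE; exact: periodic_smoothB.
Qed.

Lemma partial_mean u v k r x : psv u -> psv v ->
  partial k (fun y => mean_field u v y r 0) x =
  2^-1 * (partial k (fun y => u y r 0) x + partial k (fun y => v y r 0) x).
Proof.
move=> su sv; rewrite -(partialD k x (su r) (sv r)).
rewrite -(partialZ k _ x (periodic_smoothD (su r) (sv r))).
by congr (partial k _ x); apply/funext => y; rewrite !mxE.
Qed.

Lemma partial_diff u v k r x : psv u -> psv v ->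
  partial k (fun y => diff_field u v y r 0) x =
  partial k (fun y => u y r 0) x - partial k (fun y => v y r 0) x.
Proof.
move=> su sv; rewrite -(partialB k x (su r) (sv r)).
by congr (partial k _ x); apply/funext => y; rewrite !mxE.
Qed.

Lemma mxdot_vgrad_mean_diff u v x : psv u -> psv v ->
  mxdot (vgrad (mean_field u v) x) (vgrad (diff_field u v) x) =
  2^-1 * (mxdot (vgrad u x) (vgrad u x) - mxdot (vgrad v x) (vgrad v x)).
Proof.
move=> su sv; rewrite /mxdot -sumrB mulr_sumr; apply: eq_bigr => i _.
rewrite -sumrB mulr_sumr; apply: eq_bigr => j _.
by rewrite !mxE partial_mean// partial_diff//; ring.
Qed.

Lemma div_mean_diff u v x : psv u -> psv v ->
  div (mean_field u v) x * div (diff_field u v) x =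
  2^-1 * (div u x ^+ 2 - div v x ^+ 2).
Proof.
move=> su sv; rewrite {1 2}/div.
under eq_bigr do rewrite partial_mean//.
under [X in _ * X = _]eq_bigr do rewrite partial_diff//.
by rewrite -mulr_sumr big_split sumrB /= -/(div u x) -/(div v x); ring.
Qed.

(** The discrete product rule in each component, combined with the linearity of [curl]. *)
Lemma mxdot_curl_mean_diff u v u' v' x : psv u' -> psv v' ->
  mxdot (u x) (curl u' x) - mxdot (v x) (curl v' x) =
  mxdot (mean_field u v x) (curl (diff_field u' v') x) +
  mxdot (curl (mean_field u' v') x) (diff_field u v x).
Proof.
move=> su sv; rewrite !mxdot_col -sumrB -big_split; apply: eq_bigr => i _ /=.
by rewrite !mxE !partial_mean// !partial_diff//; field.
Qed.

Lemma mxdotDl m n (A B C : 'M[R]_(m, n)) :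
  mxdot (A + B) C = mxdot A C + mxdot B C.
Proof.
rewrite /mxdot -big_split; apply: eq_bigr => i _; rewrite -big_split.
by apply: eq_bigr => j _; rewrite mxE mulrDl.
Qed.

Lemma mxdotZl m n c (A C : 'M[R]_(m, n)) : mxdot (c *: A) C = c * mxdot A C.
Proof.
rewrite /mxdot mulr_sumr; apply: eq_bigr => i _; rewrite mulr_sumr.
by apply: eq_bigr => j _; rewrite mxE mulrA.
Qed.

Lemma mxdotNl m n (A C : 'M[R]_(m, n)) : mxdot (- A) C = - mxdot A C.
Proof. by rewrite -scaleN1r mxdotZl mulN1r. Qed.

Lemma mxdot_suml m n (A : 'I_3 -> 'M[R]_(m, n)) C :
  mxdot (\sum_i A i) C = \sum_i mxdot (A i) C.
Proof.
apply: (big_morph (fun B => mxdot B C)) => [B D|]; first exact: mxdotDl.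
by rewrite -(scale0r 0) mxdotZl mul0r.
Qed.

(** The algebra of the energy identity at one point. [T], [G], [X], [Y] are the four terms of the
    discrete gradient tested against the increment, and [Z] is what [X] becomes after integration by
    parts. [P], [D], [S] are the gradient squares, divergences and twists at the new level, and [Q],
    [E], [W] those at the old one. *)
Lemma energy_sum_rearrangement (g k T G P Q D E : 'I_3 -> R)
    (kk X Y Z S W : 'I_3 -> 'I_3 -> R) :
  (forall i j, Z i j + Y i j = 2^-1 * (S i j ^+ 2 - W i j ^+ 2)) ->
  \sum_i (- (g i * T i) - k i * G i + \sum_j kk j i * X j i +
          \sum_j kk i j * Y i j) =
  \sum_i (- g i * (T i + 2^-1 * (P i - Q i)) +
          - k i * (G i + 2^-1 * (D i ^+ 2 - E i ^+ 2)) +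
          \sum_j kk j i * (X j i - Z j i)) +
  (2^-1 * (\sum_i g i * P i + \sum_i k i * D i ^+ 2 +
           \sum_i \sum_j kk i j * S i j ^+ 2) +
   -1 * (2^-1 * (\sum_i g i * Q i + \sum_i k i * E i ^+ 2 +
                 \sum_i \sum_j kk i j * W i j ^+ 2))).
Proof.
move=> ZY.
have eg : \sum_i - g i * (T i + 2^-1 * (P i - Q i)) = - (\sum_i g i * T i) -
    2^-1 * (\sum_i g i * P i - \sum_i g i * Q i).
  rewrite -sumrB mulr_sumr -sumrN -sumrB; apply: eq_bigr => i _; ring.
have ek : \sum_i - k i * (G i + 2^-1 * (D i ^+ 2 - E i ^+ 2)) =
    - (\sum_i k i * G i) -
    2^-1 * (\sum_i k i * D i ^+ 2 - \sum_i k i * E i ^+ 2).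
  rewrite -sumrB mulr_sumr -sumrN -sumrB; apply: eq_bigr => i _; ring.
have ekk : \sum_i \sum_j kk j i * (X j i - Z j i) =
    \sum_i \sum_j kk j i * X j i + \sum_i \sum_j kk i j * Y i j -
    2^-1 * (\sum_i \sum_j kk i j * S i j ^+ 2 -
            \sum_i \sum_j kk i j * W i j ^+ 2).
  (* Exchanging the sums turns [kk j i] into [kk i j], so that all terms carry the same coefficient
     and can be compared pair by pair. *)
  rewrite [X in _ = X + _ - _]exchange_big [LHS]exchange_big -sumrB mulr_sumr.
  rewrite -big_split -sumrB; apply: eq_bigr => i _ /=.
  rewrite -sumrB mulr_sumr -big_split -sumrB; apply: eq_bigr => j _ /=.
  by have := ZY i j; move=> /(canRL (addrK _)) ->; ring.
rewrite !big_split /= eg ek ekk !sumrN; ring.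
Qed.

Lemma energy_difference (gamma k : 'I_3 -> R) (kk : 'I_3 -> 'I_3 -> R) p q :
  (forall i, psv (frame p i)) -> (forall i, psv (frame q i)) ->
  box_integral a b
    (fun x => mxdot (discrete_gradient gamma k kk p q x) (q x - p x)) =
  biaxial_energy gamma k kk a b q - biaxial_energy gamma k kk a b p.
Proof.
move=> sp sq.
pose h i := frame_half p q i; pose d i := diff_field (frame q i) (frame p i).
(* The half-step twist times the half-step frame vector: column [i] of the discrete gradient
   contains the curls of the [w j i]. *)
pose w i j x := twist_half p q i j x *: h i x.
have sh i : psv (h i) by exact: periodic_smooth_mean.
have sd i : psv (d i) by exact: periodic_smooth_diff.
have st o : (forall i, psv (frame o i)) ->
    forall i j, periodic_smooth a b (twist o i j).
  move=> so i j.
  exact: (periodic_smooth_mxdot (so i) (periodic_smooth_curl (so j))).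
have sw i j : psv (w i j).
  apply: periodic_smooth_scale => //; apply: periodic_smoothZ.
  by apply: periodic_smoothD; exact: st.
have se o : (forall i, psv (frame o i)) ->
    periodic_smooth a b (energy_density gamma k kk o).
  move=> so; apply: periodic_smoothZ; apply: periodic_smoothD.
    apply: periodic_smoothD; apply: periodic_smooth_sum => i;
      apply: periodic_smoothZ.
      apply: periodic_smooth_sum => r; apply: periodic_smooth_sum => s.
      under eq_fun do rewrite !mxE.
      by apply: periodic_smoothM; exact: periodic_smooth_partial (so i s).
    under eq_fun do rewrite expr2.
    by apply: periodic_smoothM; exact: periodic_smooth_div (so i).
  apply: periodic_smooth_sum => i; apply: periodic_smooth_sum => j.
  apply: periodic_smoothZ; under eq_fun do rewrite expr2.
  by apply: periodic_smoothM; exact: st o so i j.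
(* The remainders of the three integrations by parts, weighted as the corresponding terms of the
   discrete gradient. *)
pose G x := \sum_i
  (- gamma i * (mxdot (tdiv (vgrad (h i)) x) (d i x) +
                mxdot (vgrad (h i) x) (vgrad (d i) x)) +
   - k i * (mxdot (grad (div (h i)) x) (d i x) + div (h i) x * div (d i) x) +
   \sum_j kk j i * (mxdot (curl (w j i) x) (d i x) -
                    mxdot (w j i x) (curl (d i) x))).
have [sG G0] : null a b G.
  apply: null_sum => i; apply: nullD; first apply: nullD.
  - by apply: nullZ; exact: null_tdiv_vgrad.
  - by apply: nullZ; exact: null_grad_div.
  - by apply: null_sum => j; apply: nullZ; exact: null_curl.
(* The identity holds pointwise: the integrand is the increment of the energy density plus [G], and
   only [G] is lost in integrating. *)
rewrite (_ : (fun x => _) = (fun x => G x +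
    (energy_density gamma k kk q x + -1 * energy_density gamma k kk p x))).
  have cG := periodic_smooth_continuous sG.
  have cq := periodic_smooth_continuous (se q sq).
  have cp := periodic_smooth_continuous (periodic_smoothZ (-1) (se p sp)).
  have cpq := periodic_smooth_continuous
    (periodic_smoothD (se q sq) (periodic_smoothZ (-1) (se p sp))).
  rewrite (box_integralD a b cG cpq) G0 add0r (box_integralD a b cq cp).
  rewrite (box_integralZ a b (-1) (periodic_smooth_continuous (se p sp))).
  by rewrite mulN1r.
apply/funext => x.
have -> : mxdot (discrete_gradient gamma k kk p q x) (q x - p x) =
    \sum_i mxdot (discrete_col gamma k kk p q i x) (d i x).
  rewrite /mxdot exchange_big; apply: eq_bigr => i _.
  under [RHS]eq_bigr do rewrite big_ord1.
  by apply: eq_bigr => r _; rewrite !mxE.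
have twE i j : twist q i j x - twist p i j x =
    mxdot (h i x) (curl (d j) x) + mxdot (curl (h j) x) (d i x).
  exact: mxdot_curl_mean_diff.
pose Y i j := twist_half p q i j x * mxdot (curl (h j) x) (d i x).
pose Z i j := mxdot (w i j x) (curl (d j) x).
(* By [twE], the left-hand side is the mean of the two twists times their difference. *)
have tw2 i j : Z i j + Y i j = 2^-1 * (twist q i j x ^+ 2 - twist p i j x ^+ 2).
  rewrite /Z /Y mxdotZl -mulrDr -twE /twist_half.
  by move: (twist q i j x) (twist p i j x) => s t; ring.
rewrite /G /energy_density.
have gr i : mxdot (vgrad (h i) x) (vgrad (d i) x) = _ :=
  mxdot_vgrad_mean_diff x (sq i) (sp i).
have dv i : div (h i) x * div (d i) x = _ := div_mean_diff x (sq i) (sp i).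
under eq_bigr => i _.
  rewrite /discrete_col !mxdotDl !mxdotNl !mxdotZl !mxdot_suml.
  under [X in _ + X + _]eq_bigr do rewrite mxdotZl.
  under [X in _ + X]eq_bigr do rewrite !mxdotZl -/(Y _ _).
  over.
under [in RHS]eq_bigr do rewrite gr dv.
exact: energy_sum_rearrangement.
Qed.

End EnergyDifference.

(** * Accuracy of the average of two endpoint values *)

(** With [m] the midpoint, twice the difference is [(g u - g m) - (g m - g l)]. The mean value
    theorem turns each bracket into a value of [g'] times [(u - l) / 2]; applied once more, to [g'],
    it produces [g''] and a second factor of at most [u - l]. *)
Lemma midpoint_average (R : realType) (g g' g'' : R -> R) (l u M : R) :
  l < u ->
  (forall s, l <= s <= u -> is_derive s 1 g (g' s)) ->
  (forall s, l <= s <= u -> is_derive s 1 g' (g'' s)) ->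
  (forall s, l <= s <= u -> `|g'' s| <= M) ->
  `|2^-1 * (g u + g l) - g (l + (u - l) / 2)| <= M * (u - l) ^+ 2.
Proof.
move=> lu dg dg' g''M; set m := l + (u - l) / 2.
(* The case [c = d] is included because the points [s1] and [s2] found below may both be [m]. *)
have MVT (f f' : R -> R) c d : l <= c -> c <= d -> d <= u ->
    (forall s, l <= s <= u -> is_derive s 1 f (f' s)) ->
    exists2 s, c <= s <= d & f d - f c = f' s * (d - c).
  move=> lc cd du df.
  have sub s : c <= s <= d -> l <= s <= u.
    by move=> /andP[cs sd]; rewrite (le_trans lc cs) (le_trans sd du).
  have [//|||s] := @MVT_segment _ f f' c d.
  - by move=> s; rewrite in_itv/= => /andP[/ltW cs /ltW sd]; apply/df/sub/andP.
  - apply: derivable_within_continuous => s; rewrite in_itv/= => /sub/df fs.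
    exact: (@ex_derive _ _ _ _ _ _ _ fs).
  - by rewrite in_itv/=; exists s.
have [lm mu] : l <= m /\ m <= u by rewrite /m; split; lra.
have [s2 /andP[ms2 s2u] E2] := MVT g g' m u lm mu (lexx u) dg.
have [s1 /andP[ls1 s1m] E1] := MVT g g' l m (lexx l) lm mu dg.
have [s3 /andP[s13 s32] E3] :=
  MVT g' g'' s1 s2 ls1 (le_trans s1m ms2) s2u dg'.
have -> : 2^-1 * (g u + g l) - g m =
    2^-1 * (g'' s3 * (s2 - s1) * ((u - l) / 2)).
  rewrite -E3; suff : g u - g m - (g m - g l) =
    (g' s2 - g' s1) * ((u - l) / 2) by lra.
  by rewrite E2 E1 /m; field.
have := g''M s3; rewrite (le_trans ls1 s13) (le_trans s32 s2u) => /(_ isT) s3M.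
have M0 : 0 <= M := le_trans (normr_ge0 _) s3M.
rewrite !normrM (ger0_norm (_ : 0 <= 2^-1))// [`|u - l|]gtr0_norm ?subr_gt0//.
rewrite (ger0_norm (_ : 0 <= s2 - s1)) ?subr_ge0 ?(le_trans s1m)//.
(* The bound obtained has the constant [M / 4]; the factor [4^-1] is then given away. *)
rewrite (_ : _ * _ = `|g'' s3| * (4^-1 * (s2 - s1) * (u - l))); last by field.
apply: ler_pM => //; first by rewrite !mulr_ge0//; lra.
by rewrite expr2 ler_wpM2r//; lra.
Qed.

(** * Space-time functions that are smooth and periodic in space *)

Section SpaceTime.
Context {R : realType} (a b : 'rV[R]_3) (J : set R) (t0 t1 : R).
Hypotheses (ab : forall l, a 0 l < b 0 l) (oJ : open J).
Hypothesis t01J : `[t0, t1] `<=` J.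

Local Notation spacetime := (R^o * 'rV[R]_3)%type.
Local Notation U := (J `*` [set: 'rV[R]_3] : set spacetime).
Implicit Types (f g : spacetime -> R) (A B : R -> R -> scalar_field R).

Let oU : open U.
Proof. exact: open_cylinder. Qed.

Definition space_partial k f : spacetime -> R :=
  fun z => partial k (fun y => f (z.1, y)) z.2.

(** The two difference quotients coincide. Spatial derivatives at a fixed time thus become
    directional derivatives on space-time, to which [smooth] applies. *)
Lemma derive_slice f t x (e : 'rV[R]_3) :
  'D_e (fun y => f (t, y)) x = 'D_((0, e) : spacetime) f (t, x).
Proof.
apply: (congr1 (fun G : R -> R => lim (G h @[h --> 0^']))).
apply/funext => h; congr (_ *: (f _ - _)).
by apply: injective_projections; rewrite /= ?scaler0 ?add0r.
Qed.

Lemma derivable_slice f t x (e : 'rV[R]_3) :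
  derivable (fun y => f (t, y)) x e = derivable f (t, x) ((0, e) : spacetime).
Proof.
apply: (congr1 (fun G : R -> R => cvg (G h @[h --> 0^']))).
apply/funext => h; congr (_ *: (f _ - _)).
by apply: injective_projections; rewrite /= ?scaler0 ?add0r.
Qed.

Lemma smooth_slice f t : smooth U f -> J t -> smooth setT (fun y => f (t, y)).
Proof.
move=> sf Jt n; elim: n f sf => [|n IHn] f sf.
  split=> // x _; apply: (continuous_comp (f := fun y => (t, y))).
    exact: continuous_pairr.
  exact: (@smooth_continuous _ _ U _ (t, x) sf (conj Jt I)).
split=> [x _|e].
  apply: (continuous_comp (f := fun y => (t, y))).
    exact: continuous_pairr.
  exact: (@smooth_continuous _ _ U _ (t, x) sf (conj Jt I)).
split=> [x _|].
  rewrite derivable_slice.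
  exact: (@smooth_derivable _ _ U _ (t, x) _ sf (conj Jt I)).
have := IHn _ (smooth_derive ((0, e) : spacetime) sf).
by apply: eq_Ck openT _ _ _ _ => x _; rewrite derive_slice.
Qed.

Definition periodic_spacetime f :=
  smooth U f /\ forall t, J t -> box_periodic a b (fun x => f (t, x)).

Lemma periodic_spacetime_slice f t : periodic_spacetime f -> J t ->
  periodic_smooth a b (fun x => f (t, x)).
Proof. by move=> [sf pf] Jt; split; [exact: smooth_slice|exact: pf]. Qed.

Lemma periodic_spacetime_cst c : periodic_spacetime (fun=> c).
Proof. by split=> //; exact: smooth_cst oU c. Qed.

Lemma periodic_spacetimeD f g : periodic_spacetime f -> periodic_spacetime g ->
  periodic_spacetime (fun z => f z + g z).
Proof.
move=> [sf pf] [sg pg]; split; first exact: smoothD oU _ _ sf sg.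
by move=> t Jt k x; rewrite pf// pg.
Qed.

Lemma periodic_spacetimeM f g : periodic_spacetime f -> periodic_spacetime g ->
  periodic_spacetime (fun z => f z * g z).
Proof.
move=> [sf pf] [sg pg]; split; first exact: smoothM oU _ _ sf sg.
by move=> t Jt k x; rewrite pf// pg.
Qed.

Lemma space_partialE k f :
  space_partial k f = 'D_((0, delta_mx 0 k) : spacetime) f.
Proof. by apply/funext => -[t x]; rewrite -derive_slice. Qed.

Lemma periodic_spacetime_derive f (v : spacetime) : periodic_spacetime f ->
  periodic_spacetime ('D_v f).
Proof.
move=> [sf pf]; split; first exact: smooth_derive.
move=> t Jt k x; set c := _ *: _.
(* The direction [v] may leave the slice at time [t], so [f] is compared with its spatial translate
   on all of the open set [U]. *)
rewrite -(derive_eq_on oU (f := fun z => f (z.1, z.2 + c))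
  (x := (t, x))); last 2 first.
- by move=> [s y] [/= Js _]; exact: pf.
- by [].
apply: (congr1 (fun G : R -> R => lim (G h @[h --> 0^']))).
apply/funext => h; congr (_ *: (f _ - _)).
by apply: injective_projections => //=; rewrite addrA.
Qed.

Lemma periodic_spacetime_partial k f : periodic_spacetime f ->
  periodic_spacetime (space_partial k f).
Proof. by rewrite space_partialE; exact: periodic_spacetime_derive. Qed.

Lemma periodic_shift f t x k (m : int) : periodic_spacetime f -> J t ->
  f (t, x + (m%:~R * (b 0 k - a 0 k)) *: delta_mx 0 k) = f (t, x).
Proof.
move=> [_ /(_ t)] pf Jt; set L := b 0 k - a 0 k.
have nat_shift (n : nat) y : f (t, y + (n%:R * L) *: delta_mx 0 k) = f (t, y).
  elim: n y => [|n IHn] y; first by rewrite mul0r scale0r addr0.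
  by rewrite -natr1 mulrDl mul1r scalerDl addrA pf.
case: m => n; first exact: nat_shift.
(* A backward shift is undone by [n.+1] forward periods. *)
rewrite NegzE mulrNz mulNr scaleNr -[LHS](nat_shift n.+1).
by rewrite -addrA addNr addr0.
Qed.

(** A continuous function is bounded on the compact product of [[t0, t1]] and the box, and
    periodicity brings every point of space into the box. *)
Lemma periodic_spacetime_bounded f : periodic_spacetime f ->
  exists M, forall t, t0 <= t <= t1 -> forall x, `|f (t, x)| <= M.
Proof.
move=> pf.
pose K : set spacetime := `[t0, t1] `*` 
  [set x : 'rV[R]_3 | forall i, `[a 0 i, b 0 i]%classic (x ord0 i)].
have cK : compact K.
  apply: compact_setX; first exact: segment_compact.
  exact: (@rV_compact R 3 (fun i => `[a 0 i, b 0 i]%classic)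
    (fun i => @segment_compact _ _ _)).
have cf : {within K, continuous f}.
  apply: continuous_in_subspaceT => -[t x]; rewrite inE => -[/= /t01J Jt _].
  have [sf _] := pf.
  exact: (@smooth_continuous _ _ U _ (t, x) sf (conj Jt I)).
have /compact_bounded[M [_ mrt]] := continuous_compact cf cK.
(* [compact_bounded] provides a bound for every number strictly above [M]. *)
exists (M + 1) => t tI x.
have Jt : J t by apply: t01J; rewrite /= in_itv.
(* The number of whole periods from [a] to [x] in the direction [i]; going back by them leads to a
   point [y] of the box. *)
pose m i := Num.floor ((x 0 i - a 0 i) / (b 0 i - a 0 i)).
pose c i := (- m i)%:~R * (b 0 i - a 0 i).
pose y := x + c 0 *: delta_mx 0 0 + c 1 *: delta_mx 0 1 +
  c 2%:R *: delta_mx 0 2%:R.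
have -> : f (t, x) = f (t, y) by rewrite /y !periodic_shift.
apply: (mrt (M + 1)); first by rewrite ltrDl.
exists (t, y) => //; split => //=.
move=> i; have -> : y ord0 i = x 0 i + c i.
  by rewrite !mxE; case: (ord3_cases i) => [->|[->|->]];
    rewrite /= ?mulr1 ?mulr0 ?addr0.
have L0 : 0 < b 0 i - a 0 i by rewrite subr_gt0.
have := floor_itv ((x 0 i - a 0 i) / (b 0 i - a 0 i)); rewrite -/(m i).
rewrite ler_pdivlMr// ltr_pdivrMr// intrD mulrDl => /andP[lo hi].
rewrite in_itv/= /c mulrNz mulNr; lra.
Qed.

End SpaceTime.

(** * Calculus of second-order approximations *)

Section SecondOrder.
Context {R : realType} (a b : 'rV[R]_3) (J : set R) (t0 t1 : R).
Hypotheses (ab : forall l, a 0 l < b 0 l) (oJ : open J).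
Hypothesis t01J : `[t0, t1] `<=` J.

Local Notation spacetime := (R^o * 'rV[R]_3)%type.
Local Notation U := (J `*` [set: 'rV[R]_3] : set spacetime).
Local Notation ps := (periodic_spacetime a b J).
Implicit Types (f g : spacetime -> R) (A B : R -> R -> scalar_field R).

Definition admissible (tn tau : R) := [/\ t0 <= tn, 0 < tau & tn + tau <= t1].

Lemma admissible_in tn tau : admissible tn tau ->
  [/\ t0 <= tn <= t1, t0 <= tn + tau <= t1 & t0 <= tn + tau / 2 <= t1].
Proof. by move=> [? ? ?]; split; lra. Qed.

Lemma admissible_J tn tau : admissible tn tau ->
  [/\ J tn, J (tn + tau) & J (tn + tau / 2)].
Proof.
by move=> /admissible_in[? ? ?]; split; apply: t01J; rewrite /= in_itv.
Qed.

Definition second_order A f := exists C : R, forall tn tau,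
  admissible tn tau -> forall x,
  `|A tn tau x - f (tn + tau / 2, x)| <= C * tau ^+ 2.

(* Spatial derivatives are carried along because closeness of [A] to [f] alone
   is not stable under [partial]. *)
Fixpoint approx n A f : Prop := second_order A f /\
  if n is m.+1 then forall k,
    approx m (fun tn tau => partial k (A tn tau)) (space_partial k f)
  else True.

Lemma eq_second_order A B f g :
  (forall tn tau, admissible tn tau -> A tn tau = B tn tau) ->
  (forall t x, J t -> f (t, x) = g (t, x)) ->
  second_order A f -> second_order B g.
Proof.
move=> AB fg [C HC]; exists C => tn tau adm x.
have [_ _ Jm] := admissible_J adm.
by rewrite -AB// -fg//; exact: HC.
Qed.

Lemma eq_approx n A B f g :
  (forall tn tau, admissible tn tau -> A tn tau = B tn tau) ->
  (forall t x, J t -> f (t, x) = g (t, x)) ->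
  approx n A f -> approx n B g.
Proof.
elim: n A B f g => [|n IHn] A B f g AB fg [sA dA].
  by split=> //; exact: eq_second_order sA.
split; first exact: eq_second_order sA.
move=> k; apply: IHn (dA k) => [tn tau adm|t x Jt]; first by rewrite AB.
rewrite /space_partial/=; congr (partial k _ x).
by apply/funext => y; exact: fg.
Qed.

Lemma approxW n A f : approx n.+1 A f -> approx n A f.
Proof.
elim: n A f => [|n IHn] A f [sA dA]; split=> // k.
exact: IHn (dA k).
Qed.

(** The sum and product rules require [A] itself to be differentiable in space, which closeness to a
    smooth function does not provide. *)
Definition slice_smooth A := forall tn tau, admissible tn tau ->
  smooth setT (A tn tau).

Lemma slice_smooth_derivable A tn tau x (e : 'rV[R]_3) : slice_smooth A ->
  admissible tn tau -> derivable (A tn tau) x e.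
Proof.
move=> sA adm; exact: (@smooth_derivable _ _ setT _ x e (sA _ _ adm) I).
Qed.

Lemma second_orderD A B f g : second_order A f -> second_order B g ->
  second_order (fun tn tau x => A tn tau x + B tn tau x) (fun z => f z + g z).
Proof.
move=> [C HC] [D HD]; exists (C + D) => tn tau adm x.
rewrite opprD addrACA mulrDl (le_trans (ler_normD _ _))//.
by rewrite lerD ?HC ?HD.
Qed.

(** The error splits as [(A - f) B + f (B - g)], where [f] and [B] are bounded uniformly. *)
Lemma second_orderM A B f g : ps f -> ps g ->
  second_order A f -> second_order B g ->
  second_order (fun tn tau x => A tn tau x * B tn tau x) (fun z => f z * g z).
Proof.
move=> pf pg [C HC] [D HD].
have [M HM] := periodic_spacetime_bounded ab t01J pf.
have [N HN] := periodic_spacetime_bounded ab t01J pg.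
(* The parenthesis bounds [B]: its distance to [g] is at most [D * tau ^+ 2], and [tau <= t1 - t0].
   The absolute value covers a negative [D]. *)
exists (C * (N + `|D| * (t1 - t0) ^+ 2) + M * D) => tn tau adm x.
have [_ _ Im] := admissible_in adm; have [tn0 tau0 tn1] := adm.
set m := tn + tau / 2.
have fM : `|f (m, x)| <= M by exact: HM.
have gN : `|g (m, x)| <= N by exact: HN.
have Af := HC _ _ adm x; have Bg := HD _ _ adm x.
rewrite -/m in Af Bg.
rewrite (_ : _ - _ = (A tn tau x - f (m, x)) * B tn tau x +
                     f (m, x) * (B tn tau x - g (m, x))); last by ring.
rewrite (le_trans (ler_normD _ _))// !normrM mulrDl lerD//; last first.
  by rewrite -mulrA ler_pM.
rewrite mulrAC ler_pM// -[B tn tau x](subrK (g (m, x))) addrC.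
rewrite (le_trans (ler_normD _ _))// lerD// (le_trans Bg)//.
rewrite (le_trans (ler_wpM2r (sqr_ge0 _) (ler_norm D)))// ler_wpM2l//.
by rewrite lerXn2r ?nnegrE//; lra.
Qed.

Lemma approxD n A B f g : ps f -> ps g -> slice_smooth A -> slice_smooth B ->
  approx n A f -> approx n B g ->
  approx n (fun tn tau x => A tn tau x + B tn tau x) (fun z => f z + g z).
Proof.
elim: n A B f g => [|n IHn] A B f g pf pg sA sB [aA dA] [aB dB].
  by split=> //; exact: second_orderD.
split; first exact: second_orderD.
move=> k; apply: eq_approx (IHn _ _ _ _ _ _ _ _ (dA k) (dB k)).
- move=> tn tau adm; apply/funext => x; rewrite /partial deriveD//;
    exact: slice_smooth_derivable adm.
- move=> t x Jt; rewrite /space_partial/= (@partialD _ a b)//.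
    exact: (periodic_spacetime_slice pf Jt).
  exact: (periodic_spacetime_slice pg Jt).
- exact: periodic_spacetime_partial.
- exact: periodic_spacetime_partial.
- by move=> tn tau adm; apply: smooth_derive; exact: sA.
- by move=> tn tau adm; apply: smooth_derive; exact: sB.
Qed.

(** By the Leibniz rule, induction applies to the products with one factor differentiated; [approxW]
    lowers the order of the other factor. *)
Lemma approxM n A B f g : ps f -> ps g -> slice_smooth A -> slice_smooth B ->
  approx n A f -> approx n B g ->
  approx n (fun tn tau x => A tn tau x * B tn tau x) (fun z => f z * g z).
Proof.
elim: n A B f g => [|n IHn] A B f g pf pg sA sB aA aB;
  move: (aA) (aB) => [oA dA] [oB dB].
  by split=> //; exact: second_orderM.
split; first exact: second_orderM.
move=> k; have dpf := periodic_spacetime_partial oJ k pf.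
have dpg := periodic_spacetime_partial oJ k pg.
have dsA : slice_smooth (fun tn tau => partial k (A tn tau)).
  by move=> tn tau adm; apply: smooth_derive; exact: sA.
have dsB : slice_smooth (fun tn tau => partial k (B tn tau)).
  by move=> tn tau adm; apply: smooth_derive; exact: sB.
have pM := periodic_spacetimeM oJ.
have sM A' B' : slice_smooth A' -> slice_smooth B' ->
    slice_smooth (fun tn tau x => A' tn tau x * B' tn tau x).
  move=> sA' sB' tn tau adm.
  by apply: smoothM openT _ _ (sA' _ _ adm) (sB' _ _ adm).
have := approxD (pM _ _ _ _ dpf pg) (pM _ _ _ _ pf dpg)
  (sM _ _ dsA sB) (sM _ _ sA dsB)
  (IHn _ _ _ _ dpf pg dsA sB (dA k) (approxW aB))
  (IHn _ _ _ _ pf dpg sA dsB (approxW aA) (dB k)).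
apply: eq_approx.
- move=> tn tau adm; apply/funext => x; rewrite /partial deriveM.
  + by rewrite addrC [in RHS]/GRing.scale/= [B _ _ x * _]mulrC.
  + exact: slice_smooth_derivable adm.
  + exact: slice_smooth_derivable adm.
- move=> t x Jt; rewrite /space_partial/= (@partialM _ a b)//.
    exact: (periodic_spacetime_slice pf Jt).
  exact: (periodic_spacetime_slice pg Jt).
Qed.

(** A derivative costs one order of [approx]; asking for all orders makes the notion stable under
    [partial]. *)
Definition approximates A f :=
  [/\ ps f, slice_smooth A & forall n, approx n A f].

Lemma eq_approximates A B f g :
  (forall tn tau x, A tn tau x = B tn tau x) -> (forall z, f z = g z) ->
  approximates A f -> approximates B g.
Proof.
move=> AB /funext <-; suff -> : A = B by [].
by apply/funext => tn; apply/funext => tau; apply/funext => x; exact: AB.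
Qed.

Lemma approximatesD A B f g : approximates A f -> approximates B g ->
  approximates (fun tn tau x => A tn tau x + B tn tau x) (fun z => f z + g z).
Proof.
move=> [pf sA aA] [pg sB aB]; split=> [|tn tau adm|n].
- exact: periodic_spacetimeD.
- by apply: smoothD openT _ _ (sA _ _ adm) (sB _ _ adm).
- exact: approxD.
Qed.

Lemma approximatesM A B f g : approximates A f -> approximates B g ->
  approximates (fun tn tau x => A tn tau x * B tn tau x) (fun z => f z * g z).
Proof.
move=> [pf sA aA] [pg sB aB]; split=> [|tn tau adm|n].
- exact: periodic_spacetimeM.
- by apply: smoothM openT _ _ (sA _ _ adm) (sB _ _ adm).
- exact: approxM.
Qed.

Lemma approximates_cst c : approximates (fun _ _ _ => c) (fun=> c).
Proof.
split=> [|tn tau _|n].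
- exact: periodic_spacetime_cst.
- exact: smooth_cst openT c.
- elim: n c => [|n IHn] c; split=> //; try by
    exists 0 => tn tau _ x; rewrite subrr normr0 mul0r.
  move=> k; apply: eq_approx (IHn 0) => [tn tau _|t x _].
    by apply/funext => x; rewrite /partial derive_cst.
  by rewrite /space_partial /partial derive_cst.
Qed.

Lemma approximatesZ c A f : approximates A f ->
  approximates (fun tn tau x => c * A tn tau x) (fun z => c * f z).
Proof. exact: approximatesM (approximates_cst c). Qed.

Lemma approximates_sum (F : 'I_3 -> R -> R -> scalar_field R)
    (G : 'I_3 -> spacetime -> R) : (forall i, approximates (F i) (G i)) ->
  approximates (fun tn tau x => \sum_i F i tn tau x) (fun z => \sum_i G i z).
Proof.
move=> FG.
apply: eq_approximates (approximatesD (approximatesD (FG 0) (FG 1)) (FG 2%:R)).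
  by move=> tn tau x; rewrite sum_ord3.
by move=> z; rewrite sum_ord3.
Qed.

Lemma approximates_partial k A f : approximates A f ->
  approximates (fun tn tau => partial k (A tn tau)) (space_partial k f).
Proof.
move=> [pf sA aA]; split=> [|tn tau adm|n].
- exact: periodic_spacetime_partial.
- by apply: smooth_derive; exact: sA.
- by have [_] := aA n.+1; exact.
Qed.

Definition mean_in_time f tn tau : scalar_field R :=
  fun x => 2^-1 * (f (tn + tau, x) + f (tn, x)).

(** At fixed [x] this is [midpoint_average] in time; the second time derivative is again periodic
    and smooth, hence bounded uniformly in [x]. *)
Lemma second_order_mean f : ps f -> second_order (mean_in_time f) f.
Proof.
move=> pf; pose T : spacetime := (1, 0).
have pf1 := periodic_spacetime_derive oJ T pf.
have pf2 := periodic_spacetime_derive oJ T pf1.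
have [M HM] := periodic_spacetime_bounded ab t01J pf2.
exists M => tn tau [tn0 tau0 tn1] x.
have dline g s : ps g -> t0 <= s <= t1 ->
    is_derive s 1 (fun t => g (t, x)) ('D_T g (s, x)).
  move=> [sg _] sI; have Js : J s by apply: t01J; rewrite /= in_itv.
  (* The line starts at time zero, so that its parameter is the time itself. *)
  have E t : ((0, x) : spacetime) + t *: T = (t, x).
    apply: injective_projections; rewrite /= ?scaler0 ?addr0//.
    by rewrite add0r [_ *: _]mulr1.
  have := @is_derive_line _ _ g ((0, x) : spacetime) T s.
  rewrite E => /(_ (@smooth_derivable _ _ U _ (s, x) _ sg (conj Js I))).
  by under eq_fun do rewrite E.
have tau_eq : tn + tau - tn = tau by rewrite addrC addKr.
have sub s : tn <= s <= tn + tau -> t0 <= s <= t1 by move=> /andP[? ?]; lra.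
have := @midpoint_average _ (fun t => f (t, x)) (fun t => 'D_T f (t, x))
  (fun t => 'D_T ('D_T f) (t, x)) tn (tn + tau) M.
rewrite tau_eq; apply.
- lra.
- by move=> s /sub sI; exact: dline.
- by move=> s /sub sI; exact: dline.
- by move=> s /sub sI; exact: HM.
Qed.

Lemma mean_in_time_smooth f : ps f -> slice_smooth (mean_in_time f).
Proof.
move=> pf tn tau /admissible_J[Jn Jn1 _].
exact: (periodic_smoothZ _ (periodic_smoothD (periodic_spacetime_slice pf Jn1)
  (periodic_spacetime_slice pf Jn))).1.
Qed.

(** Spatial derivatives commute with the time average, so each order reduces to [second_order_mean]
    for a derivative of [f]. *)
Lemma approximates_mean f : ps f -> approximates (mean_in_time f) f.
Proof.
move=> pf; split=> //; first exact: mean_in_time_smooth.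
move=> n; elim: n f pf => [|n IHn] f pf; split=> //;
  try exact: second_order_mean.
move=> k; apply: eq_approx (IHn _ (periodic_spacetime_partial oJ k pf)) => //.
move=> tn tau /admissible_J[Jn Jn1 _]; apply/funext => x.
have sn := periodic_spacetime_slice pf Jn.
have sn1 := periodic_spacetime_slice pf Jn1.
rewrite [RHS](partialZ k _ _ (periodic_smoothD sn1 sn)).
by rewrite (partialD k _ sn1 sn).
Qed.

End SecondOrder.

(** * The discrete gradient as a second-order approximation of the variation *)

Section SecondOrderVariation.
Context {R : realType} (a b : 'rV[R]_3) (J : set R) (t0 t1 : R).
Hypotheses (ab : forall l, a 0 l < b 0 l) (oJ : open J).
Hypothesis t01J : `[t0, t1] `<=` J.

Local Notation spacetime := (R^o * 'rV[R]_3)%type.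
Local Notation ps := (periodic_spacetime a b J).
Implicit Types (A B : R -> R -> vector_field R) (F G : R -> vector_field R).

(** Curried form, suited to the operators of vector calculus, which act on the field at one fixed
    time. *)
Definition scalar_approximates (A : R -> R -> scalar_field R)
    (f : R -> scalar_field R) :=
  approximates a b J t0 t1 A (fun z => f z.1 z.2).

Definition vector_approximates A F := forall r,
  scalar_approximates (fun tn tau x => A tn tau x r 0) (fun t x => F t x r 0).

Local Notation "A ~s f" := (scalar_approximates A f) (at level 70).
Local Notation "A ~v F" := (vector_approximates A F) (at level 70).

Lemma scalar_approximatesB (A B : R -> R -> scalar_field R)
    (f g : R -> scalar_field R) : A ~s f -> B ~s g ->
  (fun tn tau x => A tn tau x - B tn tau x) ~s (fun t x => f t x - g t x).
Proof.
move=> Af /(approximatesZ ab oJ t01J (-1)) /(approximatesD oJ t01J Af).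
by apply: eq_approximates => [tn tau x|z]; rewrite mulN1r.
Qed.

Lemma scalar_approximates_partial k (A : R -> R -> scalar_field R)
    (f : R -> scalar_field R) : A ~s f ->
  (fun tn tau => partial k (A tn tau)) ~s (fun t => partial k (f t)).
Proof. exact: (approximates_partial oJ). Qed.

Lemma vector_approximatesD A B F G : A ~v F -> B ~v G ->
  (fun tn tau x => A tn tau x + B tn tau x) ~v (fun t x => F t x + G t x).
Proof.
move=> AF BG r; have := approximatesD oJ t01J (AF r) (BG r).
by apply: eq_approximates => [tn tau x|z]; rewrite !mxE.
Qed.

Lemma vector_approximates_scale (A : R -> R -> scalar_field R)
    (f : R -> scalar_field R) B G : A ~s f -> B ~v G ->
  (fun tn tau x => A tn tau x *: B tn tau x) ~v (fun t x => f t x *: G t x).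
Proof.
move=> Af BG r; have := approximatesM ab oJ t01J Af (BG r).
by apply: eq_approximates => [tn tau x|z]; rewrite !mxE.
Qed.

Lemma vector_approximatesZ c A F : A ~v F ->
  (fun tn tau x => c *: A tn tau x) ~v (fun t x => c *: F t x).
Proof.
apply: (@vector_approximates_scale (fun _ _ _ => c) (fun _ _ => c)).
exact: approximates_cst.
Qed.

Lemma vector_approximatesN A F : A ~v F ->
  (fun tn tau x => - A tn tau x) ~v (fun t x => - F t x).
Proof.
move=> /(vector_approximatesZ (-1)).
move=> AF r; move: (AF r).
by apply: eq_approximates => [tn tau x|z]; rewrite scaleN1r.
Qed.

Lemma vector_approximates_sum (A : 'I_3 -> R -> R -> vector_field R)
    (F : 'I_3 -> R -> vector_field R) : (forall j, A j ~v F j) ->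
  (fun tn tau x => \sum_j A j tn tau x) ~v (fun t x => \sum_j F j t x).
Proof.
move=> AF r; have := approximates_sum oJ t01J (fun j => AF j r).
by apply: eq_approximates => [tn tau x|z]; rewrite !summxE.
Qed.

Lemma vector_approximates_curl A F : A ~v F ->
  (fun tn tau => curl (A tn tau)) ~v (fun t => curl (F t)).
Proof.
move=> AF r; have := scalar_approximatesB
  (scalar_approximates_partial (r + 1) (AF (r + 2%:R)))
  (scalar_approximates_partial (r + 2%:R) (AF (r + 1))).
by apply: eq_approximates => [tn tau x|z]; rewrite !mxE.
Qed.

Lemma scalar_approximates_div A F : A ~v F ->
  (fun tn tau => div (A tn tau)) ~s (fun t => div (F t)).
Proof.
move=> AF.
exact: (approximates_sum oJ t01J
  (fun k => scalar_approximates_partial k (AF k))).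
Qed.

Lemma scalar_approximates_mxdot A B F G : A ~v F -> B ~v G ->
  (fun tn tau x => mxdot (A tn tau x) (B tn tau x)) ~s
  (fun t x => mxdot (F t x) (G t x)).
Proof.
move=> AF BG; have := approximates_sum oJ t01J
  (fun r => approximatesM ab oJ t01J (AF r) (BG r)).
by apply: eq_approximates => [tn tau x|z]; rewrite !mxdot_col.
Qed.

Lemma vector_approximates_grad (A : R -> R -> scalar_field R)
    (f : R -> scalar_field R) : A ~s f ->
  (fun tn tau => grad (A tn tau)) ~v (fun t => grad (f t)).
Proof.
move=> Af r; have := scalar_approximates_partial r Af.
by apply: eq_approximates => [tn tau x|z]; rewrite !mxE.
Qed.

Lemma vector_approximates_laplacian A F : A ~v F ->
  (fun tn tau => tdiv (vgrad (A tn tau))) ~v (fun t => laplacian (F t)).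
Proof.
move=> AF r; have := approximates_sum oJ t01J (fun k =>
  scalar_approximates_partial k (scalar_approximates_partial k (AF r))).
apply: eq_approximates => [tn tau x|z]; rewrite mxE//.
apply: eq_bigr => k _; congr (partial k _ x); apply/funext => y.
by rewrite mxE.
Qed.

Lemma discrete_col_approximates (gamma k : 'I_3 -> R)
    (kk : 'I_3 -> 'I_3 -> R) (p : R -> matrix_field R) i :
  (forall r i, ps (fun z => p z.1 z.2 r i)) ->
  (fun tn tau => discrete_col gamma k kk (p tn) (p (tn + tau)) i) ~v
  (fun t => variation_col gamma k kk (p t) i).
Proof.
move=> pp.
have half j : (fun tn tau => frame_half (p tn) (p (tn + tau)) j) ~v
    (fun t => frame (p t) j).
  move=> r; have := approximates_mean ab oJ t01J (pp r j).
  by apply: eq_approximates => [tn tau x|z]; rewrite !mxE.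
have half_twist i' j : (fun tn tau => twist_half (p tn) (p (tn + tau)) i' j) ~s
    (fun t => twist (p t) i' j).
  apply: (approximates_mean ab oJ t01J).
  (* The coefficient is the time average of the twist, not the twist of the averaged frames. This
     approximation serves only for its first component: the twist is periodic and smooth, as
     [approximates_mean] requires. *)
  have [] : scalar_approximates _ _ := scalar_approximates_mxdot (half i')
    (vector_approximates_curl (half j)).
  by [].
apply: vector_approximatesD; first apply: vector_approximatesD;
  first apply: vector_approximatesD.
- apply: vector_approximatesN; apply: vector_approximatesZ.
  exact: vector_approximates_laplacian.
- apply: vector_approximatesN; apply: vector_approximatesZ.
  by apply: vector_approximates_grad; exact: scalar_approximates_div.
- apply: vector_approximates_sum => j; apply: vector_approximatesZ.
  by apply: vector_approximates_curl; exact: vector_approximates_scale.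
- apply: vector_approximates_sum => j; apply: vector_approximatesZ.
  by apply: vector_approximates_scale => //; exact: vector_approximates_curl.
Qed.

End SecondOrderVariation.

(** * From matrix fields to their entries, and the conclusion *)

Lemma frame_periodic_smooth (R : realType) (a b : 'rV[R]_3)
    (p : matrix_field R) (i : 'I_3) :
  smooth_on [set: 'rV[R]_3] p -> box_periodic a b p ->
  periodic_smooth_vector a b (frame p i).
Proof.
move=> sp perp r.
rewrite (_ : (fun x => _) = fun x => p x r i); last first.
  by apply/funext => x; rewrite mxE.
by split; [exact: (smooth_on_entry openT)|move=> l x; rewrite perp].
Qed.

Theorem proposition2p3 (R : realType)
    (a b : 'rV[R]_3) (hab : forall l : 'I_3, a 0 l < b 0 l)
    (gamma k : 'I_3 -> R) (kk : 'I_3 -> 'I_3 -> R)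
    (hgamma : forall i : 'I_3, 0 < gamma i)
    (hk : forall i : 'I_3, 0 <= k i)
    (hkk : forall i j : 'I_3, 0 <= kk i j) :
  (forall (J : set R) (p : R -> 'rV[R]_3 -> 'M[R]_3) (t0 t1 : R),
     open J -> `[t0, t1] `<=` J ->
     smooth_on (J `*` [set: 'rV[R]_3])
       (fun z : R^o * 'rV[R]_3 => p z.1 z.2) ->
     (forall t : R, J t -> box_periodic a b (p t)) ->
     (forall (t : R) (x : 'rV[R]_3), J t -> SO3 (p t x)) ->
     exists C : R, forall tn tau : R, t0 <= tn -> 0 < tau -> tn + tau <= t1 ->
       forall x : 'rV[R]_3,
         `| discrete_gradient gamma k kk (p tn) (p (tn + tau)) x
            - energy_variation gamma k kk (p (tn + tau / 2)) x |
         <= C * tau ^+ 2) /\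
  (forall pn pn1 : 'rV[R]_3 -> 'M[R]_3,
     smooth_on [set: 'rV[R]_3] pn -> smooth_on [set: 'rV[R]_3] pn1 ->
     box_periodic a b pn -> box_periodic a b pn1 ->
     (forall x : 'rV[R]_3, SO3 (pn x)) -> (forall x : 'rV[R]_3, SO3 (pn1 x)) ->
     box_integral a b
       (fun x => mxdot (discrete_gradient gamma k kk pn pn1 x) (pn1 x - pn x))
     = biaxial_energy gamma k kk a b pn1 - biaxial_energy gamma k kk a b pn).

Proof.
split=> [J p t0 t1 oJ t01J sp perp _|p q sp sq perp perq _ _]; last first.
  exact: (energy_difference hab gamma k kk
    (fun i => frame_periodic_smooth i sp perp)
    (fun i => frame_periodic_smooth i sq perq)).
have pp r i : periodic_spacetime a b J (fun z => p z.1 z.2 r i).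
  split=> [|t Jt l x]; last by rewrite /= perp.
  exact: smooth_on_entry (open_cylinder oJ) _ _ _ _ _ sp.
have err r i : exists C : R, forall tn tau, admissible t0 t1 tn tau -> forall x,
    `|discrete_gradient gamma k kk (p tn) (p (tn + tau)) x r i -
      energy_variation gamma k kk (p (tn + tau / 2)) x r i| <= C * tau ^+ 2.
  (* Order zero of the approximation of column [i], in its component [r], is the required estimate
     of one entry. *)
  have [_ _ /(_ 0%N) [[C HC] _]] :=
    discrete_col_approximates hab oJ t01J gamma k kk i pp r.
  exists C => tn tau adm x; rewrite [X in `|X - _|]mxE [X in `|_ - X|]mxE.
  exact: HC.
pose C r i := projT1 (cid (err r i)).
(* The norm of a matrix is the largest absolute value of its entries. The sum dominates each of the
   nine constants, and its nonnegativity is used for the maximum, which starts from zero. *)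
exists (\sum_r \sum_i `|C r i|) => tn tau tn0 tau0 tn1 x.
rewrite [leLHS]/Num.Def.normr/= mx_normrE.
apply: bigmax_le => [|[r i] _].
  by rewrite mulr_ge0 ?sqr_ge0//; apply: sumr_ge0 => r _; exact: sumr_ge0.
have Cri := svalP (cid (err r i)) tn tau (And3 tn0 tau0 tn1) x.
rewrite [X in `|X|]mxE [X in _ + X]mxE (le_trans Cri)//.
rewrite ler_wpM2r ?sqr_ge0// (le_trans (ler_norm _))//.
rewrite (bigD1 r)//= (bigD1 i)//= -addrA lerDl addr_ge0 ?sumr_ge0// => r' _.
exact: sumr_ge0.
Qed.
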